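(* Let $\sigma>1$. There exists a constant $C>0$ depending only on $\sigma$ such that the following holds. Consider any $K$-armed stochastic bandit ($K\in\mathbb{Z}_+$) whose reward distributions $P_1,\dots,P_K$ with means $\mu_1,\dots,\mu_K$ are 1-sub-Gaussian, i.e. $\mathbb{E}_{r\sim P_j}e^{\lambda(r-\mu_j)}\le e^{\lambda^2/2}$ for all $\lambda\in\mathbb{R}$ and $j\in[K]$. Run MINTS with the uniform prior over $[K]$, the Gaussian likelihood with parameter $\sigma$, and parameter space $\Theta=\mathbb{R}^K$. Then for every $T\in\mathbb{Z}_+$, $$\mathbb{E}[\mathrm{Regret}(T)]\le C\inf_{\delta\ge0}\left\{\sum_{j:\,\Delta_j>\delta}\left(\frac{\log(\max\{T\Delta_j^2,e\})}{\Delta_j}+\Delta_j\right)+T\max_{j:\,\Delta_j\le\delta}\Delta_j\right\}.$$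
   Context: Notation: $[K]=\{1,\dots,K\}$. Each arm $j\in[K]$ has a reward distribution $P_j$ on $\mathbb{R}$ with mean $\mu_j$; $\Delta_j=\max_{k\in[K]}\mu_k-\mu_j$ is its suboptimality gap. At each period $t=1,2,\dots$ the agent picks an arm $x_t\in[K]$ and receives feedback $\phi_t$, which conditionally on the past data and $x_t$ is drawn from $P_{x_t}$. The dataset is $\mathcal{D}_0=\varnothing$, $\mathcal{D}_t=\mathcal{D}_{t-1}\cup\{(x_t,\phi_t)\}$. The regret is $\mathrm{Regret}(T)=\sum_{t=1}^T\Delta_{x_t}$. MINTS (minimalist Thompson sampling) with prior $Q_0$ on $[K]$, Gaussian likelihood with parameter $\sigma>0$, and parameter space $\Theta\subseteq\mathbb{R}^K$: the likelihood is $$L(\theta;\mathcal{D}_t)=\prod_{i=1}^t\frac{1}{\sqrt{2\pi}\,\sigma}\exp\left(-\frac{(\theta_{x_i}-\phi_i)^2}{2\sigma^2}\right),\quad \theta\in\Theta.$$ For $j\in[K]$ let $\Theta_j=\{v\in\Theta: v_j\ge v_k\ \forall k\in[K]\}$ and define the profile likelihood $\bar L(j;\mathcal{D}_t)=\sup_{v\in\Theta_j}L(v;\mathcal{D}_t)$. The generalized posterior is $Q_t(j)=\bar L(j;\mathcal{D}_t)Q_0(j)\big/\sum_{k=1}^K\bar L(k;\mathcal{D}_t)Q_0(k)$. At each period $t$, conditionally on $\mathcal{D}_{t-1}$, the arm $x_t$ is sampled from $Q_{t-1}$. The Gaussian model only defines the algorithm; the true rewards need not be Gaussian. *)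

(* Defs.v *)
From HB Require Import structures.
From mathcomp Require Import all_boot all_order all_algebra.
From mathcomp Require Import all_classical all_reals all_analysis.
From mathcomp Require Import measurable_realfun.

Set Implicit Arguments.
Unset Strict Implicit.
Unset Printing Implicit Defensive.

Import Order.TTheory GRing.Theory Num.Theory.
Import numFieldNormedType.Exports.

Local Open Scope classical_set_scope.
Local Open Scope ring_scope.

(* Arms are ordinals 'I_K, so arm j of [K] is the ordinal j - 1.  Likewise time
   is counted from 0: [x t] and [phi t] are the arm and the feedback of period
   t + 1, and the data available before that period are those of index < t.   *)

Section Bandit.
Context {R : realType} {K : nat}.

Definition has_mean (P : probability R R) (m : R) : Prop :=
  ('E_P[id] = m%:E)%E.

Definition one_sub_gaussian (P : probability R R) (m : R) : Prop :=
  forall lambda : R,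
    ('E_P[fun r => expR (lambda * (r - m))] <= (expR (lambda ^+ 2 / 2))%:E)%E.

(* The default value [mu j] of the maximum is itself one of the mu k. *)
Definition gap (mu : 'I_K -> R) (j : 'I_K) : R :=
  \big[Num.max/mu j]_(k < K) mu k - mu j.

Definition regret (mu : 'I_K -> R) (arms : nat -> 'I_K) (T : nat) : R :=
  \sum_(t < T) gap mu (arms t).

(* In the last term the gaps are nonnegative and, for K > 0 and delta >= 0, at
   least one of them is 0, so the default value 0 does not affect the maximum. *)
Definition regret_bound (mu : 'I_K -> R) (T : nat) (delta : R) : R :=
  \sum_(j < K | delta < gap mu j)
     (ln (Num.max (T%:R * gap mu j ^+ 2) (expR 1)) / gap mu j + gap mu j)
  + T%:R * \big[Num.max/0]_(j < K | gap mu j <= delta) gap mu j.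

End Bandit.

Section MINTS.
Context {R : realType} {K : nat}.
Implicit Types (sigma : R) (Theta : set 'rV[R]_K) (Q : 'I_K -> R).
Implicit Types (D : seq ('I_K * R)) (j : 'I_K).

Definition likelihood sigma (theta : 'rV[R]_K) D : R :=
  \prod_(z <- D) ((Num.sqrt (2 * pi) * sigma)^-1 *
    expR (- ((theta 0 z.1 - z.2) ^+ 2 / (2 * sigma ^+ 2)))).

Definition opt_region Theta j : set 'rV[R]_K :=
  [set v | Theta v /\ forall k, v 0 k <= v 0 j].

(* For sigma > 0 the likelihood is bounded in theta, so this is a true supremum
   whenever [opt_region Theta j] is nonempty. *)
Definition profile_likelihood sigma Theta j D : R :=
  sup [set likelihood sigma v D | v in opt_region Theta j].

Definition gen_posterior sigma Theta Q D j : R :=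
  profile_likelihood sigma Theta j D * Q j /
  \sum_(k < K) profile_likelihood sigma Theta k D * Q k.

Definition uniform_prior j : R := K%:R^-1.

End MINTS.

Section Interaction.
Context {R : realType} {K : nat} {d : measure_display} {Omega : measurableType d}.
Implicit Types (Pr : probability Omega R).
Implicit Types (x : nat -> Omega -> 'I_K) (phi : nat -> Omega -> R).

(* [f] is a version of the conditional probability of the event [E] given the
   sigma-algebra generated by [G]. *)
Definition is_cond_prob Pr (G : set_system Omega) (E : set Omega)
    (f : Omega -> \bar R) : Prop :=
  measurable_fun setT (f : g_sigma_algebraType G -> \bar R) /\
  forall A, <<s G >> A -> (Pr (A `&` E) = \int[Pr]_(w in A) f w)%E.

Definition dataset x phi (t : nat) (w : Omega) : seq ('I_K * R) :=
  [seq (x s w, phi s w) | s <- iota 0 t].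

(* Every subset of the finite set 'I_K is taken to be measurable. *)
Definition arm_events (a : Omega -> 'I_K) : set_system Omega :=
  preimage_set_system setT a setT.

Definition feedback_events (f : Omega -> R) : set_system Omega :=
  preimage_set_system setT f measurable.

(* Generates the sigma-algebra of the first t observations. *)
Definition data_events x phi (t : nat) : set_system Omega :=
  \bigcup_(s in `I_t) (arm_events (x s) `|` feedback_events (phi s)).

(* [policy D j] is the probability of choosing arm [j] after the data [D]. *)
Record bandit_run (P : 'I_K -> probability R R)
    (policy : seq ('I_K * R) -> 'I_K -> R) Pr x phi : Prop := BanditRun {
  arm_measurable : forall t, arm_events (x t) `<=` measurable;
  feedback_measurable : forall t, measurable_fun setT (phi t);
  arm_cond_law : forall t j,
    is_cond_prob Pr (data_events x phi t) (x t @^-1` [set j])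
      (fun w => (policy (dataset x phi t w) j)%:E);
  feedback_cond_law : forall t (B : set R), measurable B ->
    is_cond_prob Pr (data_events x phi t `|` arm_events (x t))
      (phi t @^-1` B) (fun w => P (x t w) B) }.

End Interaction.

(* Main.v *)
Require Import Defs.
From HB Require Import structures.
From mathcomp Require Import all_boot all_order all_algebra.
From mathcomp Require Import all_classical all_reals all_analysis.
From mathcomp Require Import measurable_realfun.
From mathcomp Require Import lra ring.

(** Regret is the sum over the arms of gap times number of pulls, and the arms
    of gap at most delta cost at most T times the largest such gap under any
    policy.  So it suffices to bound, for an arm j with gap Delta > 0, the
    expected number of pulls in T periods by a constant multiple of
    1 + ln (max (T Delta^2, e)) / Delta^2; this is [expected_pulls_le].  Let i
    be an arm with mu i = mu j + Delta and put eps = Delta / 3.  For an arm a,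
    N is its number of pulls so far and S ([noise]) the sum of its rewards
    centred at mu a, so that mu a + S / N is its empirical mean.

    The first ingredient is deterministic ([posterior_le]).  Take a parameter v
    for which arm j is best, and change a single coordinate of it.
    - If v_j < mu i - eps, raise or lower v_i to the larger of v_j and the
      empirical mean of i.  The new parameter has i as a best arm, and the
      likelihood of v is at most exp ((S^2 / N - N eps^2 / 2) / (2 sigma^2))
      times the new one, N and S being those of i.
    - Otherwise v_j >= mu j + 2 eps.  If the empirical mean of j is at most
      mu j + eps, moving v_j there multiplies the likelihood by at least
      exp (N eps^2 / (2 sigma^2)), N being that of j.
    Hence the posterior of j is at most an [excess] factor times the posterior
    of i, plus an exponentially small term.  The factor posterior of i matters:
    it turns the first term into an expectation over the periods in which i is
    pulled ([integral_arm_choice]), which can be summed over the number of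
    pulls of i instead of over time.

    The second ingredient is probabilistic.  At the pull of arm a that follows
    its n-th one, S / sqrt n has 1-sub-Gaussian moments, and since sigma > 1 the
    expectation of exp (S^2 / (2 sigma^2 n)) is bounded ([square_moment]).  As
    the pull times are random, sub-Gaussianity comes from the supermartingale
    exp (lambda S - lambda^2 N / 2), stopped at that pull ([expmart_stopped]);
    the square in the exponent is then dominated by a mixture over lambda in
    Z / sqrt n.  The remaining factor exp (- n kappa / (2 sigma^2)) of the
    excess makes the sum over n geometric ([expected_excess]).

    The pulls of j are split into those made while N is at most
    2 sigma^2 ln (max (T Delta^2, e)) / eps^2, those made while S > eps N, which
    are dominated by the excess of j itself, and the others, to which the
    posterior bound applies with an additive error at most 1 / (T Delta^2). *)

Set Implicit Arguments.
Unset Strict Implicit.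
Unset Printing Implicit Defensive.

Import Order.TTheory GRing.Theory Num.Theory.
Import numFieldNormedType.Exports.

Local Open Scope classical_set_scope.
Local Open Scope ring_scope.

(** * Integration against a sub-sigma-algebra *)

Section SubSigmaAlgebra.
Context {d : measure_display} {T : measurableType d} {R : realType}.
Variable G : set_system T.
Hypothesis mG : G `<=` measurable.

Lemma sub_sigma_measurable : <<s G >> `<=` (@measurable _ T).
Proof. exact: (smallest_sub (sigma_algebra_measurable _)). Qed.

Lemma sub_sigma_measurable_fun d' (U : measurableType d') (f : T -> U) :
  measurable_fun setT (f : g_sigma_algebraType G -> U) -> measurable_fun setT f.
Proof. by move=> mf _ B mB; apply: sub_sigma_measurable; exact: mf. Qed.

Import HBNNSimple.

(** The defining property of conditional expectation, extended from the
    indicators of events of the sub-sigma-algebra to nonnegative multipliers [H]: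
    it is linear in [H] on simple functions and passes to monotone limits. *)
Lemma integral_sub_sigma_mul (mu : {measure set T -> \bar R})
    (f g H : T -> R) :
  measurable_fun setT f -> measurable_fun setT g ->
  (forall w, 0 <= f w) -> (forall w, 0 <= g w) ->
  (forall A, <<s G >> A ->
    \int[mu]_(w in A) (f w)%:E = \int[mu]_(w in A) (g w)%:E)%E ->
  (forall w, 0 <= H w) ->
  measurable_fun setT (H : g_sigma_algebraType G -> R) ->
  (\int[mu]_w (H w * f w)%:E = \int[mu]_w (H w * g w)%:E)%E.
Proof.
move=> mf mg f0 g0 fg H0 mH.
have mH' : measurable_fun setT (EFin \o H : g_sigma_algebraType G -> \bar R).
  exact/measurable_EFinP.
pose H_ := nnsfun_approx measurableT mH'.
have mH_ n : measurable_fun setT (H_ n : T -> R).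
  by apply: sub_sigma_measurable_fun; exact: measurable_funP.
have pH_ n r : <<s G >> (H_ n @^-1` [set r])%classic.
  have := @measurable_funP _ _ _ _ setT (H_ n) measurableT _ (measurable_set1 r).
  by rewrite setTI.
have mpH_ n r : (@measurable _ T) (H_ n @^-1` [set r]).
  exact: sub_sigma_measurable.
(* A simple multiplier splits the integral over its finitely many level sets. *)
have level (h : T -> R) n : measurable_fun setT h -> (forall w, 0 <= h w) ->
    (\int[mu]_w (H_ n w * h w)%:E =
     \sum_(r \in range (H_ n))
       (r%:E * \int[mu]_(w in H_ n @^-1` [set r]) (h w)%:E))%E.
  move=> mh h0.
  transitivity (\int[mu]_w (\sum_(r \in range (H_ n))
      (r * \1_(H_ n @^-1` [set r]) w * h w)%:E))%E.
    apply: eq_integral => w _.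
    rewrite fsumEFin// {1}fimfunE; congr (_%:E).
    by rewrite !fsbig_finite// big_distrl.
  rewrite ge0_integral_fsum//; last 2 first.
  - move=> r; apply/measurable_EFinP; apply: measurable_funM => //.
    by apply: measurable_funM => //; exact: measurable_indic.
  - move=> r w _; rewrite lee_fin mulr_ge0//; exact: nnfun_muleindic_ge0.
  apply: eq_fsbigr => r /[!inE] -[w _ <-].
  set A := (_ @^-1` _)%classic.
  under eq_integral do rewrite -mulrA EFinM.
  rewrite ge0_integralZl_EFin//; last 2 first.
  - by move=> v _; rewrite lee_fin mulr_ge0.
  - apply/measurable_EFinP; apply: measurable_funM => //.
    exact: (measurable_indic (mpH_ n _)).
  rewrite [in RHS]integral_mkcond; congr (_ * _)%E.
  apply: eq_integral => v _; rewrite patchE indicE.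
  by case: ifP => _; rewrite ?mul1r ?mul0r.
have lim_ (h : T -> R) : measurable_fun setT h -> (forall w, 0 <= h w) ->
    (\int[mu]_w (H w * h w)%:E =
     limn (fun n => \int[mu]_w (H_ n w * h w)%:E))%E.
  move=> mh h0; rewrite -monotone_convergence//.
  - apply: eq_integral => w _; apply/esym/cvg_lim => //.
    rewrite EFinM; under eq_fun do rewrite EFinM.
    apply: cvgeZr => //; apply: cvg_nnsfun_approx => // v _.
    by rewrite lee_fin.
  - by move=> n; apply/measurable_EFinP/measurable_funM.
  - by move=> n w _; rewrite lee_fin mulr_ge0.
  - move=> w _ m n mn; rewrite lee_fin ler_wpM2r//.
    by have /lefP := nd_nnsfun_approx measurableT mH' mn; exact.
rewrite !lim_//; congr (limn _); apply/funext => n.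
by rewrite !level//; apply: eq_fsbigr => r _; congr (_ * _)%E; exact: fg.
Qed.
End SubSigmaAlgebra.

Lemma ge0_integral_mrestr d (T : measurableType d) (R : realType)
    (mu : {measure set T -> \bar R}) (A : set T) (mA : measurable A)
    (f : T -> \bar R) :
  measurable_fun setT f -> (forall w, 0 <= f w)%E ->
  (\int[mrestr mu mA]_w f w = \int[mu]_(w in A) f w)%E.
Proof.
move=> mf f0; rewrite -(setUv A) ge0_integral_setU//;
  [|exact: measurableC|by rewrite setUv|exact/disj_setPCl].
rewrite [X in (_ + X)%E](eq_measure_integral mzero); last first.
  move=> B mB BA; rewrite /= /mrestr (_ : B `&` A = set0) ?measure0//.
  by apply/disjoints_subset.
rewrite integral_measure_zero adde0; apply: eq_measure_integral => B mB BA.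
by rewrite /= /mrestr setIidl.
Qed.

(** * Conditioning in a bandit run *)

Section Process.
Context {R : realType} {K : nat} {d : measure_display} {Omega : measurableType d}.
Context {P : 'I_K -> probability R R} {policy : seq ('I_K * R) -> 'I_K -> R}.
Context {Pr : probability Omega R} {x : nat -> Omega -> 'I_K}.
Context {phi : nat -> Omega -> R}.
Hypothesis hrun : bandit_run P policy Pr x phi.

Lemma arm_event_in t a : arm_events (x t) (x t @^-1` [set a]).
Proof. by exists [set a]; rewrite ?setTI. Qed.

Lemma data_events_measurable t : data_events x phi t `<=` measurable.
Proof.
apply: bigcup_sub => s _; rewrite subUset; split.
  exact: (arm_measurable hrun).
by move=> A [B mB <-]; apply: (feedback_measurable hrun).
Qed.

Lemma feedback_info_measurable t :
  data_events x phi t `|` arm_events (x t) `<=` measurable.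
Proof.
by rewrite subUset; split; [exact: data_events_measurable|
  exact: (arm_measurable hrun)].
Qed.

Lemma arm_indicator_measurable (G : set_system Omega) t a :
  arm_events (x t) `<=` G ->
  measurable_fun setT
    ((fun w => (x t w == a)%:R : R) : g_sigma_algebraType G -> R).
Proof.
move=> xG; have mE : <<s G >> (x t @^-1` [set a]).
  by apply: sub_sigma_algebra; apply: xG; exact: arm_event_in.
rewrite (_ : (fun w => _) = \1_(x t @^-1` [set a]))%classic; last first.
  apply/funext => w; rewrite indicE; congr ((nat_of_bool _)%:R).
  by apply/eqP/idP => [e|]; rewrite inE.
exact: (@measurable_indic _ (g_sigma_algebraType G) R setT _ mE).
Qed.

Lemma arm_indicator_measurableT t a :
  measurable_fun setT (fun w => (x t w == a)%:R : R).
Proof.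
exact: (sub_sigma_measurable_fun (arm_measurable hrun (t := t))
  (@arm_indicator_measurable _ t a (@subset_refl _ _))).
Qed.

(** Tower rule for the choice of the arm: against a function of the past data,
    the indicator of [x t = a] and the probability given to [a] by the policy
    are interchangeable. *)
Lemma integral_arm_choice t a (H : Omega -> R) :
  (forall D, 0 <= policy D a) -> (forall w, 0 <= H w) ->
  measurable_fun setT (H : g_sigma_algebraType (data_events x phi t) -> R) ->
  (\int[Pr]_w (H w * (x t w == a)%:R)%:E =
   \int[Pr]_w (H w * policy (dataset x phi t w) a)%:E)%E.
Proof.
move=> q0 H0 mH; have [mq hq] := arm_cond_law hrun t a.
have mE : measurable (x t @^-1` [set a]).
  by apply: (arm_measurable hrun (t := t)); exact: arm_event_in.
apply: (integral_sub_sigma_mul (@data_events_measurable t)) => //.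
- exact: arm_indicator_measurableT.
- apply: (sub_sigma_measurable_fun (@data_events_measurable t)).
  exact/measurable_EFinP.
- move=> A GA; have mA := sub_sigma_measurable (@data_events_measurable t) GA.
  rewrite -hq// setIC -integral_indic//.
  apply: eq_integral => w _; congr ((nat_of_bool _)%:R%:E).
  by apply/eqP/idP => [e|]; rewrite inE.
Qed.

(** Tower rule for the feedback.  On an event of the past data and the chosen
    arm that is included in [x t = a], the law of [phi t] is a multiple of [P a],
    so the integral of [u (phi t)] over that event is that of a constant. *)
Lemma integral_feedback t a (H : Omega -> R) (u : R -> R) (c : R) :
  (forall w, 0 <= H w) ->
  measurable_fun setT (H : g_sigma_algebraType
    (data_events x phi t `|` arm_events (x t)) -> R) ->
  measurable_fun setT u -> (forall r, 0 <= u r) ->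
  (\int[P a]_r (u r)%:E <= c%:E)%E ->
  (\int[Pr]_w (H w * (x t w == a)%:R * u (phi t w))%:E <=
   c%:E * \int[Pr]_w (H w * (x t w == a)%:R)%:E)%E.
Proof.
move=> H0 mH mu u0 uc; set G := _ `|` _ in mH.
have mG : G `<=` measurable by exact: feedback_info_measurable.
have mphi := feedback_measurable hrun t.
have m1 := @arm_indicator_measurableT t a.
have I0 : (0 <= \int[P a]_r (u r)%:E)%E.
  by apply: integral_ge0 => r _; rewrite lee_fin.
have If : (\int[P a]_r (u r)%:E)%E \is a fin_num.
  by rewrite ge0_fin_numE//; apply: le_lt_trans uc _; exact: ltry.
(* The exact conditional value; it is only compared to [c] at the end. *)
set e := fine (\int[P a]_r (u r)%:E)%E.
have e0 : 0 <= e by exact: fine_ge0.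
have mE : <<s G >> (x t @^-1` [set a]).
  by apply: sub_sigma_algebra; right; exact: arm_event_in.
rewrite (@le_trans _ _ (e%:E * \int[Pr]_w (H w * (x t w == a)%:R)%:E)%E)//; last first.
  rewrite lee_wpmul2r//; last by rewrite fineK.
  by apply: integral_ge0 => w _; rewrite lee_fin mulr_ge0.
rewrite -ge0_integralZl_EFin//; last 2 first.
- by move=> w _; rewrite lee_fin mulr_ge0.
- apply/measurable_EFinP; apply: measurable_funM => //.
  exact: (sub_sigma_measurable_fun mG).
under [X in (X <= _)%E]eq_integral do rewrite -mulrA.
rewrite (@integral_sub_sigma_mul _ _ _ _ mG _ _
  (fun w => (x t w == a)%:R * e) H)//; last first.
- move=> A GA; have mA := sub_sigma_measurable mG GA.
  have mEO := sub_sigma_measurable mG mE.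
  set E := (x t @^-1` [set a])%classic in mE mEO.
  have mAE : measurable (A `&` E) by exact: measurableI.
  have GAE : <<s G >> (A `&` E).
    exact: (@measurableI _ (g_sigma_algebraType G)).
  pose k : {nonneg R} := NngNum (fine_ge0 (measure_ge0 Pr (A `&` E))).
  have kE : k%:num%:E = Pr (A `&` E) by rewrite /= fineK// fin_num_measure.
  have indE h : (\int[Pr]_(w in A) ((x t w == a)%:R * h w)%:E =
      \int[Pr]_(w in A `&` E) (h w)%:E :> \bar R)%E.
    rewrite [RHS]integral_mkcondr; apply: eq_integral => w _.
    rewrite patchE; case: (boolP (w \in E)).
      by rewrite inE => ->; rewrite eqxx mul1r.
    by rewrite notin_setE => /eqP/negbTE ->; rewrite mul0r.
  rewrite !indE.
  have mup : measurable_fun setT (EFin \o u) by exact/measurable_EFinP.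
  rewrite (_ : (\int[Pr]_(w in A `&` E) (u (phi t w))%:E)%E =
     (\int[pushforward (mrestr Pr mAE) (phi t)]_r (u r)%:E)%E); last first.
    rewrite (ge0_integral_pushforward mphi)//; last first.
      by move=> r _; rewrite lee_fin.
    rewrite preimage_setT ge0_integral_mrestr//.
      by apply/measurable_EFinP; exact: measurableT_comp.
    by move=> w; rewrite lee_fin.
  rewrite (eq_measure_integral (mscale k (P a))); last first.
    move=> B mB _.
    rewrite -[LHS]/(Pr (phi t @^-1` B `&` (A `&` E)))%classic setIC.
    have [_ /(_ _ GAE) ->] := feedback_cond_law hrun t mB.
    transitivity (\int[Pr]_(w in A `&` E) P a B)%E.
      by apply: eq_integral => w; rewrite inE => -[_ ->].
    by rewrite integral_cst// muleC -[RHS]/(k%:num%:E * _)%E kE.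
  rewrite ge0_integral_mscale//; last by move=> r _; rewrite lee_fin.
  by rewrite integral_cst// kE muleC fineK.
- by move=> w; rewrite mulr_ge0.
- by move=> w; rewrite mulr_ge0.
- exact: measurable_funM.
- by apply: measurable_funM => //; exact: measurableT_comp.
rewrite le_eqVlt; apply/orP; left; apply/eqP/eq_integral => w _.
by rewrite -EFinM; congr (_%:E); ring.
Qed.

End Process.

(** * Number of pulls and centred rewards *)

Section Statistics.
Context {R : realType} {K : nat}.
Implicit Types (D : seq ('I_K * R)) (a : 'I_K) (m : R).

Definition pulls D a : nat := count (fun z => z.1 == a) D.

(** [pulls D a] times the difference between the empirical mean of [a] and [m];
    as a sum it needs no convention for an arm that has not been pulled. *)
Definition noise m D a : R := \sum_(z <- D | z.1 == a) (z.2 - m).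

Lemma pulls_rcons D z a : pulls (rcons D z) a = (pulls D a + (z.1 == a))%N.
Proof. by rewrite /pulls -cats1 count_cat /= addn0. Qed.

Lemma noise_rcons m D z a :
  noise m (rcons D z) a = noise m D a + (z.1 == a)%:R * (z.2 - m).
Proof.
rewrite /noise -cats1 big_cat /= big_cons big_nil.
by case: eqP => _; rewrite ?mul1r ?mul0r ?addr0.
Qed.

Lemma noise_pulls0 m D a : pulls D a = 0%N -> noise m D a = 0.
Proof.
move=> /eqP; rewrite -leqn0 leqNgt -has_count => /hasPn h.
by rewrite /noise big_seq_cond big1// => z /andP[/h/negPf ->].
Qed.

End Statistics.

Section Trajectory.
Context {R : realType} {K : nat} {d : measure_display} {Omega : measurableType d}.
Context {P : 'I_K -> probability R R} {policy : seq ('I_K * R) -> 'I_K -> R}.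
Context {Pr : probability Omega R} {x : nat -> Omega -> 'I_K}.
Context {phi : nat -> Omega -> R}.
Hypothesis hrun : bandit_run P policy Pr x phi.
Variables (a : 'I_K) (m : R).

Local Notation N t w := (pulls (dataset x phi t w) a).
Local Notation S t w := (noise m (dataset x phi t w) a).

Lemma datasetS t w :
  dataset x phi t.+1 w = rcons (dataset x phi t w) (x t w, phi t w).
Proof. by rewrite /dataset -addn1 iotaD map_cat /= cats1 add0n. Qed.

Lemma pullsS t w : N t.+1 w = (N t w + (x t w == a))%N.
Proof. by rewrite datasetS pulls_rcons. Qed.

Lemma noiseS t w : S t.+1 w = S t w + (x t w == a)%:R * (phi t w - m).
Proof. by rewrite datasetS noise_rcons. Qed.

Lemma pulls_le t w : (N t w <= t)%N.
Proof. by rewrite (leq_trans (count_size _ _))// size_map size_iota. Qed.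

Section Measurability.
Variables (G : set_system Omega) (t : nat).
Hypothesis tG : data_events x phi t `<=` G.

Let arm_G s : (s < t)%N -> arm_events (x s) `<=` G.
Proof. by move=> st A As; apply: tG; exists s => //; left. Qed.

Lemma feedback_measurable_info s : (s < t)%N ->
  measurable_fun setT (phi s : g_sigma_algebraType G -> R).
Proof.
move=> st _ B mB; apply: sub_sigma_algebra; apply: tG; exists s => //.
by right; exists B.
Qed.

Lemma pulls_measurable :
  measurable_fun setT ((fun w => (N t w)%:R : R) : g_sigma_algebraType G -> R).
Proof.
have : (t <= t)%N by [].
elim: {-2}t => [|s IH] st.
  exact: (measurable_cst (0 : R)).
rewrite (_ : (fun w => _) =
  (fun w => (N s w)%:R : R) \+ (fun w => (x s w == a)%:R)); last first.
  by apply/funext => w; rewrite pullsS natrD.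
apply: measurable_funD; first exact: (IH (ltnW st)).
by apply: arm_indicator_measurable; exact: arm_G.
Qed.

Lemma noise_measurable :
  measurable_fun setT ((fun w => S t w : R) : g_sigma_algebraType G -> R).
Proof.
have : (t <= t)%N by [].
elim: {-2}t => [|s IH] st.
  rewrite (_ : (fun w => _) = cst 0); first exact: measurable_cst.
  by apply/funext => w; rewrite /noise /= big_nil.
rewrite (_ : (fun w => _) = (fun w => S s w : R) \+
    ((fun w => (x s w == a)%:R : R) \* (fun w => phi s w - m))); last first.
  by apply/funext => w; rewrite noiseS.
apply: measurable_funD; first exact: (IH (ltnW st)).
apply: measurable_funM; first by apply: arm_indicator_measurable; exact: arm_G.
by apply: measurable_funB => //; exact: feedback_measurable_info.
Qed.

Lemma pulls_event_measurable (p : pred nat) :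
  measurable_fun setT
    ((fun w => (p (N t w))%:R : R) : g_sigma_algebraType G -> R).
Proof.
rewrite (_ : (fun w => _) =
    (fun w => \sum_(n <- iota 0 t.+1) (p n)%:R * ((N t w)%:R == n%:R :> R)%:R)).
  apply: measurable_sum => n; apply: measurable_funM => //.
  rewrite (_ : (fun w => _) =
    (fun w => if (N t w)%:R == n%:R :> R then 1 else 0)); last first.
    by apply/funext => w; case: ifP.
  apply: measurable_fun_ifT => //.
  by apply: measurable_fun_eqr => //; exact: pulls_measurable.
apply/funext => w; rewrite (bigD1_seq (N t w)) ?iota_uniq//; last first.
  by rewrite mem_iota ltnS pulls_le.
rewrite /= eqxx mulr1 big1 ?addr0// => n nN.
by rewrite eqr_nat eq_sym (negbTE nN) mulr0.
Qed.

(** The count is at most [t], so the statistic is a finite sum over the values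
    of the count, each term being a function of [S] on a measurable event. *)
Lemma statistic_measurable (F : nat -> R -> R) :
  (forall n, measurable_fun setT (F n)) ->
  measurable_fun setT
    ((fun w => F (N t w) (S t w) : R) : g_sigma_algebraType G -> R).
Proof.
move=> mF; rewrite (_ : (fun w => _) =
    (fun w => \sum_(n <- iota 0 t.+1) (N t w == n)%:R * F n (S t w))).
  apply: measurable_sum => n; apply: measurable_funM.
    exact: (pulls_event_measurable (pred1 n)).
  by apply: measurableT_comp => //; exact: noise_measurable.
apply/funext => w; rewrite (bigD1_seq (N t w)) ?iota_uniq//; last first.
  by rewrite mem_iota ltnS pulls_le.
rewrite /= eqxx mul1r big1 ?addr0// => n nN.
by rewrite eq_sym (negbTE nN) mul0r.
Qed.

End Measurability.

Lemma statistic_measurableT t (F : nat -> R -> R) :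
  (forall n, measurable_fun setT (F n)) ->
  measurable_fun setT (fun w => F (N t w) (S t w) : R).
Proof.
move=> mF; apply: (sub_sigma_measurable_fun (data_events_measurable hrun (t := t))).
exact: statistic_measurable.
Qed.

End Trajectory.

(** * The stopped exponential supermartingale *)

Section RealIntegrals.
Context {d : measure_display} {T : measurableType d} {R : realType}.
Variable mu : {measure set T -> \bar R}.

Lemma integral_EFin_le (f g : T -> R) :
  measurable_fun setT f -> measurable_fun setT g ->
  (forall w, 0 <= f w) -> (forall w, f w <= g w) ->
  (\int[mu]_w (f w)%:E <= \int[mu]_w (g w)%:E)%E.
Proof.
move=> mf mg f0 fg; apply: ge0_le_integral => //; first [exact/measurable_EFinP|
  by move=> w _; rewrite lee_fin].
Qed.

Lemma integral_EFinD (f g : T -> R) :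
  measurable_fun setT f -> measurable_fun setT g ->
  (forall w, 0 <= f w) -> (forall w, 0 <= g w) ->
  (\int[mu]_w (f w + g w)%:E =
   \int[mu]_w (f w)%:E + \int[mu]_w (g w)%:E)%E.
Proof.
move=> mf mg f0 g0; under eq_integral do rewrite EFinD.
rewrite ge0_integralD//; first [exact/measurable_EFinP|
  by move=> w _; rewrite lee_fin].
Qed.

Lemma integral_EFinZ (c : R) (f : T -> R) :
  0 <= c -> measurable_fun setT f -> (forall w, 0 <= f w) ->
  (\int[mu]_w (c * f w)%:E = c%:E * \int[mu]_w (f w)%:E)%E.
Proof.
move=> c0 mf f0; under eq_integral do rewrite EFinM.
rewrite ge0_integralZl_EFin//; last exact/measurable_EFinP.
by move=> w _; rewrite lee_fin.
Qed.

Lemma integral_EFin_sum (I : Type) (s : seq I) (f : I -> T -> R) :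
  (forall i, measurable_fun setT (f i)) -> (forall i w, 0 <= f i w) ->
  (\int[mu]_w (\sum_(i <- s) f i w)%:E =
   \sum_(i <- s) \int[mu]_w (f i w)%:E)%E.
Proof.
move=> mf f0; under eq_integral do rewrite -sumEFin.
rewrite ge0_integral_sum//; last by move=> i w _; rewrite lee_fin.
by move=> i; exact/measurable_EFinP.
Qed.

Lemma integral_EFin_ge0 (f : T -> R) :
  (forall w, 0 <= f w) -> (0 <= \int[mu]_w (f w)%:E)%E.
Proof. by move=> f0; apply: integral_ge0 => w _; rewrite lee_fin. Qed.

End RealIntegrals.

Section Deviations.
Context {R : realType} {K : nat} {d : measure_display} {Omega : measurableType d}.
Context {P : 'I_K -> probability R R} {policy : seq ('I_K * R) -> 'I_K -> R}.
Context {Pr : probability Omega R} {x : nat -> Omega -> 'I_K}.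
Context {phi : nat -> Omega -> R}.
Hypothesis hrun : bandit_run P policy Pr x phi.
Variables (a : 'I_K) (m : R).
Hypothesis hsub : one_sub_gaussian (P a) m.

Local Notation N t w := (pulls (dataset x phi t w) a).
Local Notation S t w := (noise m (dataset x phi t w) a).

Definition expmart (lambda : R) t w : R :=
  expR (lambda * S t w - (N t w)%:R * (lambda ^+ 2 / 2)).

Let M := expmart.

Lemma sub_gaussian_normalized lambda :
  (\int[P a]_r (expR (lambda * (r - m) - lambda ^+ 2 / 2))%:E <= 1%:E)%E.
Proof.
have := hsub lambda; rewrite unlock => h.
under eq_integral do rewrite expRD mulrC.
rewrite integral_EFinZ ?expR_ge0//; first last.
- apply: measurableT_comp => //; apply: measurable_funM => //.
  exact: measurable_funB.
apply: (@le_trans _ _ ((expR (- (lambda ^+ 2 / 2)))%:E *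
  (expR (lambda ^+ 2 / 2))%:E)%E).
  by apply: lee_wpmul2l => //; rewrite lee_fin expR_ge0.
by rewrite -EFinM -expRD addNr expR0.
Qed.

Lemma pulls_event_measurableT t (p : pred nat) :
  measurable_fun setT (fun w => (p (N t w))%:R : R).
Proof.
exact: (statistic_measurableT hrun a m t (F := fun n _ => (p n)%:R : R)).
Qed.

Lemma expmart_measurable lambda n :
  measurable_fun setT
    (fun y : R => expR (lambda * y - n%:R * (lambda ^+ 2 / 2))).
Proof.
apply: measurableT_comp => //; apply: measurable_funB => //.
Qed.

Lemma expmart_event_measurable (G : set_system Omega) (p : pred nat) lambda t :
  data_events x phi t `<=` G ->
  measurable_fun setT
   ((fun w => (p (N t w))%:R * M lambda t w : R) : g_sigma_algebraType G -> R).
Proof.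
move=> tG.
apply: (statistic_measurable a m tG (F := fun n y =>
  (p n)%:R * expR (lambda * y - n%:R * (lambda ^+ 2 / 2)))) => n.
by apply: measurable_funM => //; exact: expmart_measurable.
Qed.

Lemma expmart_event_measurableT (p : pred nat) lambda t :
  measurable_fun setT (fun w => (p (N t w))%:R * M lambda t w : R).
Proof.
apply: (sub_sigma_measurable_fun (data_events_measurable hrun (t := t))).
exact: expmart_event_measurable.
Qed.

(** With [U t] the integral of the supermartingale over the event of at most [n]
    pulls, and [V t] its integral over the event that period [t] is the pull that
    follows the [n]-th one: [U t.+1 + V t <= U t].  Only a pull made while
    [N t < n] modifies the process without stopping it, and there the factor it
    acquires has conditional mean at most 1. *)
Lemma expmart_step lambda n t :
  (\int[Pr]_w ((N t.+1 w <= n)%:R * M lambda t.+1 w)%:E +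
   \int[Pr]_w ((N t w == n)%:R * M lambda t w * (x t w == a)%:R)%:E <=
   \int[Pr]_w ((N t w <= n)%:R * M lambda t w)%:E)%E.
Proof.
have M0 s w : 0 <= M lambda s w by exact: expR_ge0.
have mM p s := expmart_event_measurableT p lambda s.
have mx s b := arm_indicator_measurableT hrun s b.
pose u r := expR (lambda * (r - m) - lambda ^+ 2 / 2).
have mu_ : measurable_fun setT u.
  apply: measurableT_comp => //; apply: measurable_funB => //.
  by apply: measurable_funM => //; exact: measurable_funB.
pose idle w := (N t w <= n)%:R * M lambda t w * (1 - (x t w == a)%:R).
pose pulled w := (N t w < n)%:R * M lambda t w * (x t w == a)%:R.
pose last w := (N t w == n)%:R * M lambda t w * (x t w == a)%:R.
have idle0 w : 0 <= idle w.
  by rewrite !mulr_ge0// subr_ge0; case: (_ == _).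
have pulled0 w : 0 <= pulled w by rewrite !mulr_ge0.
have last0 w : 0 <= last w by rewrite !mulr_ge0.
have midle : measurable_fun setT idle.
  by apply: measurable_funM; [exact: (mM (leq^~ n))|exact: measurable_funB].
have mpulled : measurable_fun setT pulled.
  by apply: measurable_funM => //; exact: (mM (ltn^~ n)).
have mlast : measurable_fun setT last.
  by apply: measurable_funM => //; exact: (mM (pred1 n)).
have -> : (\int[Pr]_w ((N t.+1 w <= n)%:R * M lambda t.+1 w)%:E =
    \int[Pr]_w (idle w)%:E + \int[Pr]_w (pulled w * u (phi t w))%:E)%E.
  rewrite -integral_EFinD//; first last.
  - by move=> w; rewrite mulr_ge0// expR_ge0.
  - apply: measurable_funM => //; apply: measurableT_comp => //.
    exact: (feedback_measurable hrun).
  apply: eq_integral => w _; congr (_%:E).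
  rewrite /idle /pulled /M /expmart /u pullsS noiseS.
  case: (x t w == a); last first.
    by rewrite addn0 mul0r addr0 subr0 mulr1 !mulr0 mul0r addr0.
  rewrite addn1 subrr !mulr0 add0r mul1r mulr1 -mulrA -expRD.
  by congr (_ * expR _); rewrite -natr1; ring.
have -> : (\int[Pr]_w ((N t w <= n)%:R * M lambda t w)%:E =
    \int[Pr]_w (idle w)%:E + \int[Pr]_w (pulled w)%:E +
    \int[Pr]_w (last w)%:E)%E.
  rewrite -integral_EFinD// -integral_EFinD//; first last.
  - by move=> w; rewrite addr_ge0.
  - exact: measurable_funD.
  apply: eq_integral => w _; congr (_%:E).
  rewrite /idle /pulled /last leq_eqVlt; case: (ltngtP (N t w) n) => _ /=; ring.
apply: leeD => //; apply: leeD => //.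
have := @integral_feedback _ _ _ _ _ _ _ _ _ hrun t a
  (fun w => (N t w < n)%:R * M lambda t w) u 1.
rewrite mul1e; apply => //.
- by move=> w; rewrite mulr_ge0.
- by apply: (expmart_event_measurable (ltn^~ n)); exact: subsetUl.
- by move=> r; exact: expR_ge0.
- exact: sub_gaussian_normalized.
Qed.

(** Telescoping of the previous inequality from [U 0 = 1]; the left-hand side is
    the part of the stopped supermartingale that has stopped before [T]. *)
Lemma expmart_stopped lambda n T :
  (\sum_(t < T)
    \int[Pr]_w ((N t w == n)%:R * M lambda t w * (x t w == a)%:R)%:E <= 1)%E.
Proof.
have M0 s w : 0 <= M lambda s w by exact: expR_ge0.
apply: (@le_trans _ _ (\int[Pr]_w ((N T w <= n)%:R * M lambda T w)%:E +
  \sum_(t < T)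
    \int[Pr]_w ((N t w == n)%:R * M lambda t w * (x t w == a)%:R)%:E)%E).
  by rewrite leeDr//; apply: integral_EFin_ge0 => w; rewrite mulr_ge0.
elim: T => [|T IH].
  rewrite big_ord0 adde0 (eq_integral (cst 1%E)).
    by rewrite integral_cst//= probability_setT mul1e.
  move=> w _; rewrite /M /expmart /noise /= big_nil.
  by rewrite mulr0 mul0r subrr expR0 mulr1.
rewrite big_ord_recr /= addeCA addeC; apply: le_trans IH.
by rewrite leeD2r//; exact: expmart_step.
Qed.

End Deviations.

(** * Exponential square moment of the empirical mean *)

Lemma geometric_sum_le (R : realType) (q : R) T : 0 < q -> q < 1 ->
  \sum_(k < T) q ^+ k <= (1 - q)^-1.
Proof.
move=> q0 q1; have := geometric_le_lim T ler01 q0.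
rewrite gtr0_norm// => /(_ q1); rewrite div1r /series/= big_mkord; apply: le_trans.
by under [leRHS]eq_bigr do rewrite mul1r.
Qed.

Section SquareMoment.
Context {R : realType}.
Variable sigma : R.
Hypothesis hsigma : 1 < sigma.

Let rho : R := 1 - sigma ^- 2.
Let q : R := expR (- (rho / 2)).

Definition square_const : R := 2 * expR 2^-1 / (1 - q).

Let sigma_gt0 : 0 < sigma. Proof. exact: lt_trans hsigma. Qed.

Let rho_gt0 : 0 < rho.
Proof.
by rewrite subr_gt0 invf_lt1 ?exprn_gt0// expr_gt1// ltW.
Qed.

Let q_gt0 : 0 < q. Proof. exact: expR_gt0. Qed.

Let q_lt1 : q < 1.
Proof. by rewrite expR_lt1 oppr_lt0 divr_gt0. Qed.

Lemma square_const_gt0 : 0 < square_const.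
Proof. by rewrite divr_gt0 ?mulr_gt0 ?expR_gt0// subr_gt0. Qed.

(** Writing [rho = 1 - sigma ^- 2], so that [q = expR (- (rho / 2))], let
    [k] be the integer part of the absolute value of [w].  Then [k |w| - k^2 / 2]
    is at least [w^2 / 2 - 1 / 2], and the weight [q ^+ k] costs at most
    [rho w^2 / 2] because [k <= k^2 <= w^2]; what remains is
    [w^2 / (2 sigma^2) - 1 / 2]. *)
Lemma expR_square_cover (w : R) : exists k : nat,
  expR (w ^+ 2 / (2 * sigma ^+ 2)) <= expR 2^-1 * q ^+ k *
    (expR (k%:R * w - k%:R ^+ 2 / 2) + expR (- k%:R * w - k%:R ^+ 2 / 2)).
Proof.
have pos (v : R) : 0 <= v -> exists k : nat,
    expR (v ^+ 2 / (2 * sigma ^+ 2)) <=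
    expR 2^-1 * q ^+ k * expR (k%:R * v - k%:R ^+ 2 / 2).
  move=> v0; exists (Num.truncn v); set k := Num.truncn v.
  have /andP[kv vk] : k%:R <= v < k.+1%:R by exact: truncn_itv.
  rewrite /q -expRM_natl -!expRD ler_expR.
  have -> : v ^+ 2 / (2 * sigma ^+ 2) = (1 - rho) * v ^+ 2 / 2.
    by rewrite /rho; field; rewrite gt_eqF.
  have r0 := rho_gt0; clearbody rho.
  have k0 : (0 : R) <= k%:R by [].
  have kk : (k%:R : R) <= k%:R ^+ 2.
    by rewrite -natrX ler_nat -mulnn; case: (k) => // j; rewrite leq_pmulr.
  move: vk; rewrite -natr1 => vk.
  have h1 : (v - k%:R) ^+ 2 <= 1 by rewrite expr_le1 ?subr_ge0//; lra.
  have h2 : 0 <= rho * (v ^+ 2 - k%:R).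
    apply: mulr_ge0; first exact: ltW.
    by rewrite subr_ge0 (le_trans kk)// ler_sqr.
  rewrite -mulr_natl; nra.
have [w0|w0] := leP 0 w.
  have [k hk] := pos w w0; exists k; apply: (le_trans hk).
  by rewrite ler_pM2l ?mulr_gt0 ?exprn_gt0 ?expR_gt0// lerDl expR_ge0.
have [|k hk] := pos (- w); first by rewrite oppr_ge0 ltW.
exists k; rewrite sqrrN mulrN in hk; apply: (le_trans hk).
by rewrite ler_pM2l ?mulr_gt0 ?exprn_gt0 ?expR_gt0// mulNr lerDr expR_ge0.
Qed.

Context {K : nat} {d : measure_display} {Omega : measurableType d}.
Context {P : 'I_K -> probability R R} {policy : seq ('I_K * R) -> 'I_K -> R}.
Context {Pr : probability Omega R} {x : nat -> Omega -> 'I_K}.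
Context {phi : nat -> Omega -> R}.
Hypothesis hrun : bandit_run P policy Pr x phi.
Variables (a : 'I_K) (m : R).
Hypothesis hsub : one_sub_gaussian (P a) m.

Local Notation N t w := (pulls (dataset x phi t w) a).
Local Notation S t w := (noise m (dataset x phi t w) a).

(** The expectation, summed over the possible times of the pull of [a] that
    follows the [n]-th one.  For [n = 0] the division yields 0 and [S = 0], so
    the bound still holds. *)
Lemma square_moment n T :
  (\sum_(t < T) \int[Pr]_w ((N t w == n)%:R *
      expR (S t w ^+ 2 / n%:R / (2 * sigma ^+ 2)) * (x t w == a)%:R)%:E <=
   square_const%:E)%E.
Proof.
(* For [n = 0] this is 0, which makes [expmart] equal to 1 on the event. *)
pose lam (k : nat) : R := k%:R / Num.sqrt n%:R.
pose V l t w := (N t w == n)%:R *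
  expmart (phi := phi) (x := x) a m l t w * (x t w == a)%:R.
have V0 l t w : 0 <= V l t w by rewrite !mulr_ge0// expR_ge0.
have mV l t : measurable_fun setT (V l t).
  apply: measurable_funM.
    exact: (expmart_event_measurableT hrun a m (pred1 n)).
  exact: (arm_indicator_measurableT hrun).
pose F t k w := expR 2^-1 * q ^+ k * (V (lam k) t w + V (- lam k) t w).
have c0 k : 0 <= expR 2^-1 * q ^+ k.
  by rewrite mulr_ge0 ?expR_ge0// exprn_ge0// ltW.
have F0 t k w : 0 <= F t k w.
  by rewrite mulr_ge0 ?addr_ge0.
have mF t k : measurable_fun setT (F t k).
  by apply: measurable_funM => //; exact: measurable_funD.
have cover t w : (((N t w == n)%:R *
     expR (S t w ^+ 2 / n%:R / (2 * sigma ^+ 2)) * (x t w == a)%:R)%:E <=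
     \sum_(0 <= k <oo) (F t k w)%:E)%E.
  have [k hk] := expR_square_cover (S t w / Num.sqrt n%:R).
  apply: (@le_trans _ _ (F t k w)%:E); last first.
    apply: le_trans (nneseries_lim_ge (m := 0) k.+1 _); last first.
      by move=> i _ _; rewrite lee_fin.
    rewrite big_mkord big_ord_recr /= leeDr// sume_ge0// => i _.
    by rewrite lee_fin.
  rewrite lee_fin /F /V -mulrDl -mulrDr mulrA.
  rewrite ler_wpM2r//.
  case: eqP => [Nn|_]; last by rewrite !mul0r mulr0.
  rewrite !mul1r /expmart Nn.
  move: hk; rewrite expr_div_n sqr_sqrtr// => hk.
  apply: (le_trans hk); rewrite ler_wpM2l//.
  have [n0|n0] := posnP n.
    have S0 : S t w = 0 by apply: noise_pulls0; rewrite Nn.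
    rewrite S0 n0 !mul0r !mulr0 !sub0r oppr0 expR0.
    by apply: lerD; rewrite expR_le1 oppr_le0 divr_ge0// sqr_ge0.
  have sn : Num.sqrt n%:R ^+ 2 = n%:R :> R by rewrite sqr_sqrtr.
  have sn0 : Num.sqrt n%:R != 0 :> R by rewrite sqrtr_eq0 -ltNge ltr0n.
  move: sn sn0; rewrite /lam; move: (Num.sqrt _) => s sn sn0.
  rewrite -sn; apply: lerD; rewrite ler_expR le_eqVlt; apply/orP; left;
    by apply/eqP; field.
apply: (@le_trans _ _
  (\sum_(t < T) \sum_(0 <= k <oo) \int[Pr]_w (F t k w)%:E)%E).
  apply: lee_sum => t _.
  rewrite -integral_nneseries//; last 2 first.
  - by move=> k; exact/measurable_EFinP.
  - by move=> k w _; rewrite lee_fin.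
  apply: ge0_le_integral => //.
  - apply/measurable_EFinP; apply: measurable_funM; last first.
      exact: (arm_indicator_measurableT hrun).
    apply: (statistic_measurableT hrun a m t (F := fun k y =>
      (k == n)%:R * expR (y ^+ 2 / n%:R / (2 * sigma ^+ 2)))) => k.
    apply: measurable_funM => //; apply: measurableT_comp => //.
    by apply: measurable_funM => //; apply: measurable_funM.
  - apply: (ge0_emeasurable_sum (P := xpredT)) => k.
      by move=> w _ _; rewrite lee_fin.
    by move=> _; exact/measurable_EFinP.
rewrite -nneseries_sum; last first.
  by move=> t k _; exact: integral_EFin_ge0.
apply: lime_le.
  apply: is_cvg_nneseries => k _ _; apply: sume_ge0 => t _.
  exact: integral_EFin_ge0.
apply: nearW => M.
rewrite big_mkord.
apply: (@le_trans _ _ (\sum_(k < M) (2 * (expR 2^-1 * q ^+ k))%:E)%E); last first.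
  rewrite sumEFin lee_fin -mulr_sumr -mulr_sumr mulrA.
  rewrite ler_wpM2l ?mulr_ge0 ?expR_ge0//.
  exact: (geometric_sum_le M q_gt0 q_lt1).
apply: lee_sum => k _.
under eq_bigr => t _.
  rewrite integral_EFinZ//; last 2 first.
  - exact: measurable_funD.
  - by move=> w; rewrite addr_ge0.
  rewrite integral_EFinD//.
  over.
rewrite -ge0_sume_distrr; last first.
  by move=> t _; rewrite adde_ge0//; exact: integral_EFin_ge0.
rewrite big_split /= (mulrC 2) [leRHS]EFinM lee_wpmul2l ?lee_fin//.
by rewrite (_ : 2%:E = 1 + 1)%E//; apply: leeD; exact: (expmart_stopped hrun hsub).
Qed.

End SquareMoment.

(** * Profile likelihoods and the posterior *)

Section Likelihood.
Context {R : realType} {K : nat}.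
Variable sigma : R.
Hypothesis sigma_gt0 : 0 < sigma.
Implicit Types (D : seq ('I_K * R)) (a i j : 'I_K) (v : 'rV[R]_K).

Let c0 : R := (Num.sqrt (2 * pi) * sigma)^-1.

Let c0_gt0 : 0 < c0.
Proof. by rewrite invr_gt0 mulr_gt0// sqrtr_gt0 mulr_gt0// pi_gt0. Qed.

Let s2_gt0 : 0 < 2 * sigma ^+ 2.
Proof. by rewrite mulr_gt0// exprn_gt0. Qed.

Lemma likelihood_gt0 v D : 0 < likelihood sigma v D.
Proof. by apply: prodr_gt0 => z _; rewrite mulr_gt0// expR_gt0. Qed.

Lemma likelihood_le v D : likelihood sigma v D <= c0 ^+ size D.
Proof.
rewrite /likelihood -/c0; elim: D => [|z D IH]; first by rewrite big_nil.
rewrite big_cons /= (exprS c0) ler_pM//.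
- by rewrite mulr_ge0 ?expR_ge0// ltW.
- by apply: prodr_ge0 => y _; rewrite mulr_ge0 ?expR_ge0// ltW.
by rewrite ger_pMr// expR_le1 oppr_le0 divr_ge0 ?sqr_ge0// ltW.
Qed.

Definition set_coord v a (c : R) : 'rV[R]_K :=
  \row_k (if k == a then c else v 0 k).

(** The exponent is a polynomial in [noise], with no empirical mean in it, so
    the identity holds also when [a] has not been pulled. *)
Lemma likelihood_set_coord m v D a c :
  likelihood sigma v D = likelihood sigma (set_coord v a (m + c)) D *
    expR (- (((pulls D a)%:R * ((v 0 a - m) ^+ 2 - c ^+ 2) -
              2 * (v 0 a - m - c) * noise m D a) / (2 * sigma ^+ 2))).
Proof.
rewrite /likelihood -/c0 /pulls /noise.
elim: D => [|z D IH].
  by rewrite !big_nil /= mul0r mulr0 subrr mul0r oppr0 expR0 mulr1.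
rewrite !big_cons IH /= mxE natrD.
case: eqP => [->|_] /=; last by rewrite add0r mulrA.
set p := (X in _ * (X * _) = _).
rewrite [X in _ = _ * X * _](_ : _ = p)//; clearbody p.
rewrite mulrA (mulrAC c0) -(mulrA (c0 * p)) (mulrAC c0 _ p) -(mulrA (c0 * p)).
rewrite -!expRD; congr (_ * expR _).
set n : R := (count _ _)%:R; set S := \sum_(_ <- _ | _) _.
by field; rewrite gt_eqF.
Qed.

Lemma profile_ge j v D : (forall k, v 0 k <= v 0 j) ->
  likelihood sigma v D <= profile_likelihood sigma setT j D.
Proof.
move=> vj; apply: ub_le_sup; last by exists v.
exists (c0 ^+ size D) => _ [u _ <-]; exact: likelihood_le.
Qed.

Lemma profile_le j D (b : R) :
  (forall v, (forall k, v 0 k <= v 0 j) -> likelihood sigma v D <= b) ->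
  profile_likelihood sigma setT j D <= b.
Proof.
move=> vb; apply: ge_sup; last by move=> _ [v [_ vj] <-]; exact: vb.
by exists (likelihood sigma 0 D); exists 0 => //; split=> // k; rewrite !mxE.
Qed.

Lemma profile_gt0 j D : 0 < profile_likelihood sigma setT j D.
Proof.
apply: (@lt_le_trans _ _ (likelihood sigma 0 D)); first exact: likelihood_gt0.
by apply: profile_ge => k; rewrite !mxE.
Qed.

(** Every parameter lies in the region of one of its largest coordinates. *)
Lemma likelihood_le_sum j v D :
  likelihood sigma v D <= \sum_k profile_likelihood sigma setT k D.
Proof.
pose i := [arg max_(i > j) v 0 i]%O.
have vi k : v 0 k <= v 0 i by rewrite /i; case: arg_maxP => // l _; exact.
rewrite (bigD1 i)//= (le_trans (profile_ge D vi))// lerDl.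
by apply: sumr_ge0 => k _; exact/ltW/profile_gt0.
Qed.

Lemma posteriorE D j : gen_posterior sigma setT uniform_prior D j =
  profile_likelihood sigma setT j D / \sum_k profile_likelihood sigma setT k D.
Proof.
rewrite /gen_posterior /uniform_prior -mulr_suml invfM invrK.
rewrite mulrACA mulVf ?mulr1// pnatr_eq0; by case: (K) j => // -[].
Qed.

Lemma posterior_ge0 D j : 0 <= gen_posterior sigma setT uniform_prior D j.
Proof.
rewrite posteriorE divr_ge0 ?(ltW (profile_gt0 _ _))//.
by apply: sumr_ge0 => k _; exact/ltW/profile_gt0.
Qed.

(** For [kappa >= 0] and an arm [a] already pulled, it exceeds 1 exactly when
    the empirical mean of [a] is further than [Num.sqrt kappa] from [m].  So it
    dominates the indicator of that deviation; it also dominates the change of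
    likelihood in [posterior_le] when arm [a] underperforms. *)
Definition excess (kappa m : R) D a : R :=
  expR ((noise m D a ^+ 2 / (pulls D a)%:R - (pulls D a)%:R * kappa) /
    (2 * sigma ^+ 2)).

(** Both cases compare [v], for which [j] is best, to a parameter differing from
    it in one coordinate; the threshold [mu i - eps] separates the [v] that are
    pessimistic about [i] from those that are optimistic about [j]. *)
Lemma posterior_le (mu : 'I_K -> R) (eps : R) D i j :
  0 < eps -> mu j + 3 * eps <= mu i ->
  noise (mu j) D j <= eps * (pulls D j)%:R ->
  gen_posterior sigma setT uniform_prior D j <=
    excess (eps ^+ 2 / 2) (mu i) D i *
      gen_posterior sigma setT uniform_prior D i +
    expR (- ((pulls D j)%:R * eps ^+ 2 / (2 * sigma ^+ 2))).
Proof.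
move=> e0 ij Sj; rewrite !posteriorE.
set Z := \sum_k _.
have Z0 : 0 < Z.
  by apply: lt_le_trans (likelihood_le_sum j 0 D); exact: likelihood_gt0.
rewrite mulrA ler_pdivrMr// mulrDl divfK ?gt_eqF//.
apply: profile_le => v vj.
have mean a : noise (mu a) D a =
    (pulls D a)%:R * (noise (mu a) D a / (pulls D a)%:R).
  have [n0|n0] := eqVneq (pulls D a) 0%N.
    by rewrite noise_pulls0// !mul0r mulr0.
  by rewrite mulrCA divff ?mulr1// pnatr_eq0.
have [vlt|vge] := ltP (v 0 j) (mu i - eps).
  set S := noise (mu i) D i; set n : R := (pulls D i)%:R.
  pose w := S / n; pose y := v 0 j - mu i.
  apply: ler_wpDr.
    by rewrite mulr_ge0 ?expR_ge0// ltW.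
  (* The lower bound [y] on the new coordinate keeps it above [v_j], the
     largest of the others. *)
  rewrite (@likelihood_set_coord (mu i) v D i (Num.max w y)) mulrC.
  apply: ler_pM; rewrite ?expR_ge0 ?(ltW (likelihood_gt0 _ _))//; last first.
    apply: profile_ge => k; rewrite !mxE eqxx.
    have yy : v 0 j = mu i + y by rewrite /y; lra.
    case: ifP => // _; rewrite (le_trans (vj k))// yy lerD2l.
    by rewrite le_max lexx orbT.
  rewrite ler_expR -mulNr ler_pM2r ?invr_gt0// -/S -/n /excess.
  have Sw : S = n * w by rewrite /w; exact: mean.
  have -> : S ^+ 2 / n = n * w ^+ 2 by rewrite expr2 -mulrA -/w {1}Sw; ring.
  rewrite {}Sw.
  set z := v 0 i - mu i; set c := Num.max w y.
  have -> : - (n * (z ^+ 2 - c ^+ 2) - 2 * (z - c) * (n * w)) =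
      n * ((c - w) ^+ 2 - (z - w) ^+ 2) by ring.
  rewrite -mulrBr; apply: ler_wpM2l; first exact: ler0n.
  have zy : z <= y by rewrite lerD2r.
  have ye : y < - eps by rewrite /y; lra.
  clearbody w y z; rewrite /c; case: (leP w y) => wy.
    have h1 : 0 <= (- y - eps) * (y - 2 * w - eps) by apply: mulr_ge0; lra.
    have h2 : 0 <= eps * (- 2 * w - 2 * eps) by apply: mulr_ge0; lra.
    have h3 : 0 <= (z - w) ^+ 2 by exact: sqr_ge0.
    nra.
  have h1 : 0 <= (- z - eps) * (- z + eps) by apply: mulr_ge0; lra.
  have h2 : 0 <= (2 * w - z) ^+ 2 by exact: sqr_ge0.
  nra.
set S := noise (mu j) D j; set n : R := (pulls D j)%:R.
pose w := S / n.
apply: ler_wpDl.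
  by rewrite mulr_ge0 ?expR_ge0// ltW// profile_gt0.
rewrite (@likelihood_set_coord (mu j) v D j w) mulrC.
apply: ler_pM; rewrite ?expR_ge0 ?(ltW (likelihood_gt0 _ _))//; last first.
  exact: likelihood_le_sum.
rewrite ler_expR lerN2 ler_pM2r ?invr_gt0// -/S -/n.
have Sw : S = n * w by rewrite /w; exact: mean.
have -> : n * ((v 0 j - mu j) ^+ 2 - w ^+ 2) - 2 * (v 0 j - mu j - w) * S =
   n * (v 0 j - mu j - w) ^+ 2 by rewrite Sw; ring.
apply: ler_wpM2l; first exact: ler0n.
have : w <= eps.
  have [n0|n0] := eqVneq n 0; first by rewrite /w n0 invr0 mulr0 ltW.
  by rewrite ler_pdivrMr// lt_def n0 ler0n.
by move: vge ij; clearbody w => *; rewrite ler_sqr ?nnegrE; lra.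
Qed.

End Likelihood.

(** * Expected number of pulls of a suboptimal arm *)

Section ExpectedPulls.
Context {R : realType}.
Variable sigma : R.
Hypothesis hsigma : 1 < sigma.

Let sigma_gt0 : 0 < sigma. Proof. exact: lt_trans hsigma. Qed.
Let s2_gt0 : 0 < 2 * sigma ^+ 2.
Proof. by rewrite mulr_gt0// exprn_gt0. Qed.

Let C1 : R := square_const sigma.

Lemma geometric_expR_le (y : R) T : 0 < y ->
  \sum_(n < T) expR (- y) ^+ n <= 1 + y^-1.
Proof.
move=> y0; set r := expR (- y).
have r0 : 0 < r by exact: expR_gt0.
have r1 : r < 1 by rewrite expR_lt1 oppr_lt0.
apply: (le_trans (geometric_sum_le T r0 r1)).
rewrite -div1r ler_pdivrMr ?subr_gt0//.
have : (1 + y) * r <= 1.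
  by rewrite -ler_pdivlMr// div1r -expRN opprK expR_ge1Dx.
have := mulVf (lt0r_neq0 y0); set z := y^-1 => zy h.
have z0 : 0 < z by rewrite invr_gt0.
have : z * ((1 + y) * r) <= z * 1 by rewrite ler_pM2l.
have -> : z * ((1 + y) * r) = z * r + (z * y) * r by ring.
rewrite zy; lra.
Qed.

Context {K : nat} {d : measure_display} {Omega : measurableType d}.
Context {P : 'I_K -> probability R R}.
Context {Pr : probability Omega R} {x : nat -> Omega -> 'I_K}.
Context {phi : nat -> Omega -> R} {mu : 'I_K -> R}.

Local Notation policy := (gen_posterior sigma setT (@uniform_prior R K)).
Hypothesis hrun : bandit_run P policy Pr x phi.
Hypothesis hsub : forall j, one_sub_gaussian (P j) (mu j).

Local Notation D t w := (dataset x phi t w).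

Lemma excess_measurable (G : set_system Omega) kappa a t :
  data_events x phi t `<=` G ->
  measurable_fun setT ((fun w => excess sigma kappa (mu a) (D t w) a : R) :
    g_sigma_algebraType G -> R).
Proof.
move=> tG; apply: (statistic_measurable a (mu a) tG (F := fun n y =>
  expR ((y ^+ 2 / n%:R - n%:R * kappa) / (2 * sigma ^+ 2)))) => n.
apply: measurableT_comp => //; apply: measurable_funM => //.
by apply: measurable_funB => //; apply: measurable_funM.
Qed.

(** Sorting the pulls of [a] by rank rather than by date: the one that follows
    the [n]-th contributes [expR (- n kappa / (2 sigma^2))] times a bounded
    square moment. *)
Lemma expected_excess kappa a T : 0 < kappa ->
  (\sum_(t < T) \int[Pr]_w
     (excess sigma kappa (mu a) (D t w) a * (x t w == a)%:R)%:E <=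
   (C1 * (1 + 2 * sigma ^+ 2 / kappa))%:E)%E.
Proof.
move=> k0; set y := kappa / (2 * sigma ^+ 2).
have y0 : 0 < y by rewrite divr_gt0.
pose F n t w := (pulls (D t w) a == n)%:R *
  expR (noise (mu a) (D t w) a ^+ 2 / n%:R / (2 * sigma ^+ 2)) * (x t w == a)%:R.
have F0 n t w : 0 <= F n t w by rewrite !mulr_ge0// expR_ge0.
have mF n t : measurable_fun setT (F n t).
  apply: measurable_funM; last exact: (arm_indicator_measurableT hrun).
  apply: (statistic_measurableT hrun a (mu a) t (F := fun k y =>
    (k == n)%:R * expR (y ^+ 2 / n%:R / (2 * sigma ^+ 2)))) => k.
  apply: measurable_funM => //; apply: measurableT_comp => //.
  by apply: measurable_funM => //; apply: measurable_funM.
have split t w : (t < T)%N ->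
    excess sigma kappa (mu a) (D t w) a * (x t w == a)%:R =
    \sum_(n < T) expR (- y) ^+ n * F n t w.
  move=> tT; have NT : (pulls (D t w) a < T)%N.
    exact: leq_ltn_trans (pulls_le _ _ _) tT.
  rewrite (bigD1 (Ordinal NT))//= big1 => [|n]; last first.
    by rewrite -val_eqE /= /F eq_sym => /negbTE ->; rewrite !mul0r mulr0.
  rewrite addr0 /F eqxx mul1r mulrA -expRM_natl -expRD /excess /y.
  congr (expR _ * _); set z := _ ^+ 2 / _.
  by field; rewrite gt_eqF.
apply: (@le_trans _ _ (\sum_(t < T) \sum_(n < T)
    (expR (- y) ^+ n)%:E * \int[Pr]_w (F n t w)%:E)%E).
  apply: lee_sum => t _.
  under eq_integral do rewrite split//.
  rewrite integral_EFin_sum; first last.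
  - by move=> n w; rewrite mulr_ge0// exprn_ge0// expR_ge0.
  - by move=> n; exact: measurable_funM.
  apply: lee_sum => n _.
  by rewrite integral_EFinZ// exprn_ge0// expR_ge0.
rewrite exchange_big /=.
apply: (@le_trans _ _ (\sum_(n < T) (expR (- y) ^+ n * C1)%:E)%E).
  apply: lee_sum => n _.
  rewrite -ge0_sume_distrr; last by move=> t _; exact: integral_EFin_ge0.
  rewrite EFinM lee_wpmul2l ?lee_fin ?exprn_ge0 ?expR_ge0//.
  exact: (square_moment hsigma hrun (hsub a)).
rewrite sumEFin lee_fin -mulr_suml mulrC ler_pM2l ?square_const_gt0//.
by apply: (le_trans (geometric_expR_le T y0)); rewrite /y invf_div.
Qed.

Lemma early_pulls_le a (L T : nat) w :
  (\sum_(t < T) ((pulls (D t w) a <= L) && (x t w == a)) <=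
   minn (pulls (D T w) a) L.+1)%N.
Proof.
elim: T => [|T IH]; first by rewrite big_ord0.
rewrite big_ord_recr pullsS /= (leq_trans (leq_add IH (leqnn _)))//.
case: (x T w == a); last by rewrite andbF !addn0.
rewrite andbT leq_min; have [h|h] := boolP (pulls _ _ <= L)%N.
  by rewrite leq_add2r geq_minl addn1 ltnS (leq_trans (geq_minl _ _)).
by rewrite addn0 (leq_trans (geq_minl _ _)) ?leq_addr// geq_minr.
Qed.

Definition pulls_const : R := 1 + 18 * sigma ^+ 2 + (2 + 54 * sigma ^+ 2) * C1.

(** Each pull of [j] is early, or made while the empirical mean of [j] exceeds
    [mu j + eps], or [good]; a good period is charged to a pull of [i]. *)
Lemma expected_pulls_le (i j : 'I_K) (Delta : R) T : (0 < T)%N ->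
  0 < Delta -> Delta = mu i - mu j ->
  (\sum_(t < T) \int[Pr]_w ((x t w == j)%:R)%:E <=
   (pulls_const *
     (1 + ln (Num.max (T%:R * Delta ^+ 2) (expR 1)) / Delta ^+ 2))%:E)%E.
Proof.
move=> T0 D0 Dij; set B := Num.max _ _; set l := ln B.
pose eps := Delta / 3.
have e0 : 0 < eps by rewrite divr_gt0.
have B0 : 0 < B by rewrite lt_max expR_gt0 orbT.
have TD0 : 0 < T%:R * Delta ^+ 2 by rewrite mulr_gt0 ?ltr0n ?exprn_gt0.
have l1 : 1 <= l.
  by rewrite -[leLHS]expRK ler_ln ?posrE ?expR_gt0// le_max lexx orbT.
(* Beyond this many pulls, the last term of [posterior_le] is at most
   [expR (- l)], that is, at most [r]. *)
pose Lr := 2 * sigma ^+ 2 * l / eps ^+ 2.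
have Lr0 : 0 <= Lr.
  by rewrite divr_ge0 ?sqr_ge0// mulr_ge0 ?(ltW s2_gt0)// (le_trans ler01).
pose L := Num.truncn Lr.
have /andP[LLr LrL] : L%:R <= Lr < L.+1%:R by exact: truncn_itv.
pose N t w := pulls (D t w) j; pose S t w := noise (mu j) (D t w) j.
pose early t w := ((N t w <= L)%N && (x t w == j))%:R : R.
pose good t w := (L < N t w)%:R * (S t w <= eps * (N t w)%:R)%R%:R : R.
pose r := (T%:R * Delta ^+ 2)^-1 : R.
have mx t a := arm_indicator_measurableT hrun t a.
have mexc t a kappa : measurable_fun setT
    (fun w => excess sigma kappa (mu a) (D t w) a : R).
  apply: (sub_sigma_measurable_fun (data_events_measurable hrun (t := t))).
  exact: excess_measurable.
have mgood t (G : set_system Omega) : data_events x phi t `<=` G ->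
    measurable_fun setT (good t : g_sigma_algebraType G -> R).
  move=> tG; apply: (statistic_measurable j (mu j) tG (F := fun n y =>
    (L < n)%:R * (y <= eps * n%:R)%R%:R)) => n.
  apply: measurable_funM => //.
  rewrite (_ : (fun y => _) = (fun y => if y <= eps * n%:R then 1 else 0)).
    by apply: measurable_fun_ifT => //; apply: measurable_fun_ler.
  by apply/funext => y; case: ifP.
have mgoodT t : measurable_fun setT (good t).
  apply: (sub_sigma_measurable_fun (data_events_measurable hrun (t := t))).
  exact: mgood.
have mearly t : measurable_fun setT (early t).
  rewrite (_ : early t = fun w => (N t w <= L)%:R * (x t w == j)%:R).
    apply: measurable_funM => //.
    exact: (pulls_event_measurableT hrun j 0 t (leq^~ L)).
  by apply/funext => w; rewrite /early -natrM mulnb.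
have mpol t a : measurable_fun setT (fun w => policy (D t w) a).
  apply: (sub_sigma_measurable_fun (data_events_measurable hrun (t := t))).
  by apply/measurable_EFinP; have [] := arm_cond_law hrun t a.
have good0 t w : 0 <= good t w by rewrite mulr_ge0.
have exc0 kappa a t w : 0 <= excess sigma kappa (mu a) (D t w) a.
  exact: expR_ge0.
have pol0 D' a : 0 <= policy D' a by exact: posterior_ge0.
have cover t w : (x t w == j)%:R <= early t w +
    (excess sigma (eps ^+ 2) (mu j) (D t w) j * (x t w == j)%:R +
     good t w * (x t w == j)%:R).
  rewrite /early; case: (x t w == j); last by rewrite andbF !mulr0 !addr0.
  rewrite andbT !mulr1; case: leqP => LN; first by rewrite lerDl addr_ge0.
  rewrite add0r /good LN mul1r; case: (leP (S t w)) => SN; first by rewrite lerDr.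
  rewrite addr0 -[leLHS]expR0 ler_expR.
  apply: divr_ge0; last exact: ltW.
  have n0 : 0 < (N t w)%:R :> R by rewrite ltr0n (leq_ltn_trans _ LN).
  rewrite subr_ge0 ler_pdivlMr// -/(N t w) -/(S t w).
  have -> : (N t w)%:R * eps ^+ 2 * (N t w)%:R = (eps * (N t w)%:R) ^+ 2 by ring.
  have eN : 0 < eps * (N t w)%:R by rewrite mulr_gt0.
  by rewrite ler_sqr ?nnegrE ?(ltW SN) ?(ltW eN) ?(ltW (lt_trans eN SN)).
have goodP t w : good t w * policy (D t w) j <=
    excess sigma (eps ^+ 2 / 2) (mu i) (D t w) i * policy (D t w) i + r.
  have r0 : 0 < r by rewrite invr_gt0.
  have rhs0 : 0 <= excess sigma (eps ^+ 2 / 2) (mu i) (D t w) i *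
      policy (D t w) i + r.
    by apply: addr_ge0; [exact: mulr_ge0|exact: ltW].
  rewrite /good; case: leqP => LN; first by rewrite !mul0r.
  case: (leP (S t w)) => SN; last by rewrite mulr0 mul0r.
  rewrite !mul1r; have ij : mu j + 3 * eps <= mu i.
    by rewrite /eps mulrC divfK// Dij; lra.
  apply: (le_trans (posterior_le sigma_gt0 e0 ij SN)); rewrite lerD2l.
  have LrN : Lr <= (N t w)%:R by rewrite (le_trans (ltW LrL))// ler_nat.
  apply: (@le_trans _ _ (expR (- l))).
    rewrite ler_expR lerN2 ler_pdivlMr//.
    by move: LrN; rewrite /Lr ler_pdivrMr ?exprn_gt0// mulrC.
  rewrite expRN lnK ?posrE// /r lef_pV2 ?posrE//.
  by rewrite le_max lexx.
have int_cst (c : R) : (\int[Pr]_w c%:E = c%:E)%E.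
  by rewrite (integral_cst _ measurableT) /= probability_setT mule1.
have int_good t : (\int[Pr]_w (good t w * (x t w == j)%:R)%:E <=
    \int[Pr]_w (excess sigma (eps ^+ 2 / 2) (mu i) (D t w) i *
       (x t w == i)%:R)%:E + r%:E)%E.
  rewrite (integral_arm_choice hrun)//; last exact: mgood.
  rewrite (integral_arm_choice hrun)//; last exact: excess_measurable.
  rewrite -[X in (_ <= _ + X)%E]int_cst.
  rewrite -integral_EFinD//; first last.
  - by move=> w; rewrite invr_ge0 ltW.
  - by move=> w; rewrite mulr_ge0.
  - exact: measurable_funM.
  apply: integral_EFin_le => //.
  - exact: measurable_funM.
  - by apply: measurable_funD => //; exact: measurable_funM.
  - by move=> w; rewrite mulr_ge0.
apply: (@le_trans _ _ (\sum_(t < T) (\int[Pr]_w (early t w)%:E +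
   (\int[Pr]_w (excess sigma (eps ^+ 2) (mu j) (D t w) j * (x t w == j)%:R)%:E +
    (\int[Pr]_w (excess sigma (eps ^+ 2 / 2) (mu i) (D t w) i *
       (x t w == i)%:R)%:E + r%:E)))%E)).
  apply: lee_sum => t _.
  apply: (@le_trans _ _ (\int[Pr]_w (early t w +
    (excess sigma (eps ^+ 2) (mu j) (D t w) j * (x t w == j)%:R +
     good t w * (x t w == j)%:R))%:E)%E).
    apply: integral_EFin_le => //.
    apply: measurable_funD => //.
    by apply: measurable_funD; apply: measurable_funM.
  rewrite integral_EFinD//; first last.
  - by move=> w; rewrite addr_ge0// mulr_ge0.
  - by apply: measurable_funD; apply: measurable_funM.
  apply: leeD => //; rewrite integral_EFinD//; first last.
  - by move=> w; rewrite mulr_ge0.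
  - by move=> w; rewrite mulr_ge0.
  - exact: measurable_funM.
  - exact: measurable_funM.
  exact: leeD.
rewrite big_split /= [X in (_ + X)%E]big_split /=.
rewrite [X in (_ + (_ + X))%E]big_split /=.
have early_le : (\sum_(t < T) \int[Pr]_w (early t w)%:E <= (Lr + 1)%:E)%E.
  rewrite -integral_EFin_sum//.
  apply: (@le_trans _ _ (\int[Pr]_w (Lr + 1)%:E)%E); last by rewrite int_cst.
  apply: integral_EFin_le => //.
  - exact: measurable_sum.
  - by move=> w; exact: sumr_ge0.
  move=> w; rewrite /early -natr_sum.
  apply: (@le_trans _ _ L.+1%:R); last by rewrite -natr1 lerD2r.
  by rewrite ler_nat (leq_trans (early_pulls_le _ _ _ _))// geq_minr.
have hj := expected_excess j T (exprn_gt0 2 e0).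
have hi := expected_excess i T (divr_gt0 (exprn_gt0 2 e0) (ltr0n R 2)).
apply: (le_trans (leeD early_le (leeD hj (leeD hi (lexx _))))).
rewrite sumEFin big_const_ord iter_addr_0 -!EFinD lee_fin.
have -> : r *+ T = (Delta ^+ 2)^-1.
  by rewrite /r -mulr_natr; field; rewrite !gt_eqF// ltr0n.
rewrite /Lr /eps /pulls_const.
have C10 : 0 < C1 by exact: square_const_gt0.
set D2 := (Delta ^+ 2)^-1.
have D20 : 0 < D2 by rewrite invr_gt0 exprn_gt0.
have s0 : 0 <= sigma ^+ 2 by exact: sqr_ge0.
have -> : 2 * sigma ^+ 2 * l / (Delta / 3) ^+ 2 = 18 * sigma ^+ 2 * (l * D2).
  by rewrite /D2; field; rewrite gt_eqF.
have -> : 2 * sigma ^+ 2 / (Delta / 3) ^+ 2 = 18 * sigma ^+ 2 * D2.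
  by rewrite /D2; field; rewrite gt_eqF.
have -> : 2 * sigma ^+ 2 / ((Delta / 3) ^+ 2 / 2) = 36 * sigma ^+ 2 * D2.
  by rewrite /D2; field; rewrite gt_eqF.
have lD : D2 <= l * D2 by rewrite ler_peMl// ltW.
set X := l * D2 in lD *.
have X0 : 0 < X by exact: lt_le_trans lD.
have h1 : 0 <= C1 * sigma ^+ 2 * (X - D2).
  by apply: mulr_ge0; [exact: mulr_ge0 (ltW C10) s0|rewrite subr_ge0].
have h2 : 0 <= C1 * X by apply: mulr_ge0; exact: ltW.
have h3 : 0 <= sigma ^+ 2 * C1 by exact: mulr_ge0 s0 (ltW C10).
nra.
Qed.

End ExpectedPulls.

(** * Regret *)

Lemma pulls_const_ge1 (R : realType) (sigma : R) :
  1 < sigma -> 1 <= pulls_const sigma.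
Proof.
move=> hs; have s0 : 0 <= sigma ^+ 2 by exact: sqr_ge0.
have c0 := ltW (square_const_gt0 hs).
have sc0 := mulr_ge0 s0 c0.
by rewrite /pulls_const; nra.
Qed.

Lemma gap_ge0 (R : realType) K (mu : 'I_K -> R) j : 0 <= gap mu j.
Proof. by rewrite subr_ge0 le_bigmax. Qed.

Lemma gap_best_arm (R : realType) K (mu : 'I_K -> R) j :
  exists i, gap mu j = mu i - mu j.
Proof.
pose i := [arg max_(i > j) mu i]%O.
have mi k : mu k <= mu i by rewrite /i; case: arg_maxP => // l _; exact.
exists i; congr (_ - _); apply/eqP; rewrite eq_le le_bigmax andbT.
by apply/bigmax_leP; split=> // k _; exact: mi.
Qed.

(** The arms of gap at most [delta] are charged by period and not by arm: each
    period costs at most the largest of their gaps. *)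
Lemma regret_le (R : realType) K (mu : 'I_K -> R) (arms : nat -> 'I_K) T delta :
  regret mu arms T <=
  \sum_(j < K | delta < gap mu j) gap mu j * \sum_(t < T) (arms t == j)%:R +
  T%:R * \big[Num.max/0]_(j < K | gap mu j <= delta) gap mu j.
Proof.
rewrite /regret; set b := \big[Num.max/0]_(_ < K | _) _.
have b0 : 0 <= b by exact: bigmax_ge_id.
under [X in _ <= X + _]eq_bigr do rewrite mulr_sumr.
have -> : T%:R * b = \sum_(t < T) b by rewrite big_const_ord iter_addr_0 mulr_natl.
rewrite [X in _ <= X + _]exchange_big /= -big_split /=.
apply: ler_sum => t _; have [h|h] := ltP delta (gap mu (arms t)).
  rewrite (bigD1 (arms t))//= eqxx mulr1 -addrA lerDl addr_ge0// sumr_ge0// => k _.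
  by rewrite mulr_ge0// gap_ge0.
apply: ler_wpDl; first by apply: sumr_ge0 => k _; rewrite mulr_ge0// gap_ge0.
exact: le_bigmax_cond.
Qed.

Lemma expected_regret_le (R : realType) (sigma : R) (K : nat)
    (P : 'I_K -> probability R R) (mu : 'I_K -> R)
    (d : measure_display) (Omega : measurableType d) (Pr : probability Omega R)
    (x : nat -> Omega -> 'I_K) (phi : nat -> Omega -> R) (T : nat) (delta : R) :
  1 < sigma -> (forall j, one_sub_gaussian (P j) (mu j)) ->
  bandit_run P (gen_posterior sigma setT uniform_prior) Pr x phi ->
  (0 < T)%N -> 0 <= delta ->
  ('E_Pr[fun w => regret mu (x ^~ w) T] <=
    (pulls_const sigma * regret_bound mu T delta)%:E)%E.
Proof.
move=> hsigma hsub hrun T0 delta0; rewrite unlock.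
have mx t a := arm_indicator_measurableT hrun t a.
have mpulls j : measurable_fun setT (fun w => \sum_(t < T) (x t w == j)%:R : R).
  exact: measurable_sum.
set b := \big[Num.max/0]_(j < K | gap mu j <= delta) gap mu j.
have b0 : 0 <= b by exact: bigmax_ge_id.
have C1 := pulls_const_ge1 hsigma.
have mregret : measurable_fun setT (fun w => regret mu (x ^~ w) T).
  rewrite /regret; apply: measurable_sum => t.
  rewrite (_ : (fun w => _) = fun w => \sum_j gap mu j * (x t w == j)%:R).
    by apply: measurable_sum => j; exact: measurable_funM.
  apply/funext => w; rewrite (bigD1 (x t w))//= eqxx mulr1 big1 ?addr0// => j.
  by rewrite eq_sym => /negbTE ->; rewrite mulr0.
have msum : measurable_fun setT (fun w => \sum_(j < K | delta < gap mu j)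
    gap mu j * \sum_(t < T) (x t w == j)%:R).
  rewrite (_ : (fun w => _) = fun w => \sum_(j < K)
    (if delta < gap mu j then gap mu j else 0) * \sum_(t < T) (x t w == j)%:R).
    by apply: measurable_sum => j; exact: measurable_funM.
  apply/funext => w; rewrite big_mkcond /=; apply: eq_bigr => j _.
  by case: ifP; rewrite ?mul0r.
have sum0 w : 0 <= \sum_(j < K | delta < gap mu j)
    gap mu j * \sum_(t < T) (x t w == j)%:R :> R.
  by apply: sumr_ge0 => j _; rewrite mulr_ge0 ?gap_ge0// sumr_ge0.
apply: (@le_trans _ _ (\int[Pr]_w (\sum_(j < K | delta < gap mu j)
    gap mu j * \sum_(t < T) (x t w == j)%:R + T%:R * b)%:E)%E).
  apply: integral_EFin_le => //.
  - exact: measurable_funD.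
  - by move=> w; apply: sumr_ge0 => t _; exact: gap_ge0.
  - by move=> w; exact: regret_le.
rewrite integral_EFinD//; last by move=> w; rewrite mulr_ge0.
rewrite (integral_cst _ measurableT) /= probability_setT mule1.
rewrite /regret_bound -/b mulrDr EFinD.
apply: leeD; last by rewrite lee_fin ler_peMl// mulr_ge0.
rewrite -(big_filter _ (fun j => delta < gap mu j)).
under eq_integral do rewrite -big_filter.
rewrite integral_EFin_sum; first last.
- by move=> j w; rewrite mulr_ge0 ?gap_ge0// sumr_ge0.
- by move=> j; exact: measurable_funM.
rewrite !big_filter mulr_sumr -sumEFin; apply: lee_sum => j dj.
have gj : 0 < gap mu j by exact: le_lt_trans dj.
rewrite integral_EFinZ//; first last.
- by move=> w; exact: sumr_ge0.
- exact: gap_ge0.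
rewrite integral_EFin_sum//.
have [i ij] := gap_best_arm mu j.
apply: (@le_trans _ _ ((gap mu j)%:E * (pulls_const sigma *
     (1 + ln (Num.max (T%:R * gap mu j ^+ 2) (expR 1)) / gap mu j ^+ 2))%:E)%E).
  rewrite lee_wpmul2l ?lee_fin ?gap_ge0//.
  exact: (expected_pulls_le hsigma hrun hsub (i := i)).
rewrite -EFinM lee_fin le_eqVlt; apply/orP; left; apply/eqP; field.
by rewrite gt_eqF.
Qed.

Theorem theorem4p2 (R : realType) (sigma : R) (hsigma : 1 < sigma) :
  exists C : R, 0 < C /\
  forall (K : nat) (hK : (0 < K)%N)
    (P : 'I_K -> probability R R) (mu : 'I_K -> R)
    (hmean : forall j, has_mean (P j) (mu j))
    (hsub : forall j, one_sub_gaussian (P j) (mu j))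
    (d : measure_display) (Omega : measurableType d) (Pr : probability Omega R)
    (x : nat -> Omega -> 'I_K) (phi : nat -> Omega -> R)
    (hrun : bandit_run P (gen_posterior sigma setT uniform_prior) Pr x phi)
    (T : nat) (hT : (0 < T)%N),
  ('E_Pr[fun w => regret mu (x ^~ w) T] <=
    (C * inf [set regret_bound mu T delta | delta in [set a | (0 <= a)%R]])%:E)%E.
Proof.
have C0 : 0 < pulls_const sigma := lt_le_trans ltr01 (pulls_const_ge1 hsigma).
exists (pulls_const sigma).
split=> // K _ P mu _ hsub d Omega Pr x phi hrun T T0.
have bound delta := expected_regret_le (delta := delta) hsigma hsub hrun T0.
have E0 : (0 <= 'E_Pr[fun w => regret mu (x ^~ w) T])%E.
  by apply: expectation_ge0 => w; apply: sumr_ge0 => t _; exact: gap_ge0.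
have Efin : ('E_Pr[fun w => regret mu (x ^~ w) T])%E \is a fin_num.
  by rewrite ge0_fin_numE// (le_lt_trans (bound 0 _)) ?ltry.
rewrite -(fineK Efin) lee_fin mulrC -ler_pdivrMr//.
apply: lb_le_inf; first by exists (regret_bound mu T 0); exists 0 => //=.
move=> _ [delta /= delta0 <-].
by rewrite ler_pdivrMr// mulrC -lee_fin (fineK Efin); exact: bound.
Qed.
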